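(* Let $k\ge0$ and $\ell\ge0$ be fixed integers. For all $n\ge2$ large enough that $\mathfrak{b}_n\ge\max(k,\ell)$, $$q_n(k,\ell)=\frac{\mathbb{E}\left[\binom{\alpha-1}{k}\binom{\beta-1}{\ell}\right]}{\binom{\mathfrak{b}_n}{k}\binom{\mathfrak{b}_n}{\ell}},$$ where $\alpha=\alpha(\rho)$, $\beta=\beta(\rho)$ for $\rho\in\mathfrak{B}_n$ uniformly random; and as $n\to\infty$, $$q_n(k,\ell)\sim\frac{2\cdot3^{k+\ell}}{(k+\ell+1)\binom{3(k+\ell)+2}{3k+1}(2k+1)\binom{2k}{k}(2\ell+1)\binom{2\ell}{\ell}}.$$
   Context: $\mathfrak{S}_n$ is the set of permutations of $[n]=\{1,\dots,n\}$, in one-line notation. A reduction of $\omega\in\mathfrak{S}_n$ interchanges $\omega(i)$ and $\omega(j)$ for some $i<j$ with $\omega(i)>\omega(j)$. Bruhat order: $\pi\le\sigma$ if $\pi$ is obtained from $\sigma$ by a (possibly empty) sequence of reductions. $\mathfrak{B}_n\subseteq\mathfrak{S}_n$ is the set of bigrassmannian permutations, i.e. those $\omega$ such that both $\omega$ and $\omega^{-1}$ have exactly one descent; equivalently $\omega=1\cdots a\,(b+1)\cdots c\,(a+1)\cdots b\,(c+1)\cdots n$ for some $0\le a<b<c\le n$. $\mathfrak{b}_n=|\mathfrak{B}_n|=\binom{n+1}{3}$. For $\omega\in\mathfrak{B}_n$, $\beta(\omega)$ is the number of $\pi\in\mathfrak{B}_n$ with $\pi\le\omega$, and $\alpha(\omega)$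 is the number of $\tau\in\mathfrak{B}_n$ with $\omega\le\tau$. A $(k,\ell)$-star is a triple $(\Pi,\{\rho\},\Sigma)$ of subsets of $\mathfrak{B}_n$ with $|\Pi|=k$, $|\Sigma|=\ell$ and $\pi>\rho>\sigma$ for all $\pi\in\Pi$, $\sigma\in\Sigma$ (with $\Pi$ or $\Sigma$ empty if $k=0$ or $\ell=0$). Writing $\binom{\mathfrak{B}_n}{k}$ for the collection of $k$-element subsets of $\mathfrak{B}_n$, $q_n(k,\ell)$ is the probability that a uniformly random element of $\binom{\mathfrak{B}_n}{k}\times\binom{\mathfrak{B}_n}{1}\times\binom{\mathfrak{B}_n}{\ell}$ is a $(k,\ell)$-star. $f(n)\sim g(n)$ means $f(n)/g(n)\to1$. *)

(* Defs.v *)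
From HB Require Import structures.
From mathcomp Require Export all_boot all_order all_fingroup all_algebra.
From mathcomp Require Export all_classical all_reals all_analysis.

Set Implicit Arguments.
Unset Strict Implicit.
Unset Printing Implicit Defensive.

Import Order.TTheory GRing.Theory Num.Theory.
Import numFieldNormedType.Exports.

Local Open Scope ring_scope.

(** Permutations of [n] are elements of ['S_n], so positions and values run
    over [{0, ..., n-1}] instead of [{1, ..., n}]. *)

(** [tperm i j * s] maps [x] to [s (tperm i j x)]: its one-line notation is
    that of [s] with the entries at positions [i] and [j] interchanged. *)
Definition reduction (n : nat) (s p : 'S_n) : bool :=
  [exists i : 'I_n, exists j : 'I_n,
     [&& (i < j)%N, (s j < s i)%N & p == (tperm i j * s)%g]].

Definition bruhat_le (n : nat) (p s : 'S_n) : bool :=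
  connect (@reduction n) s p.

Definition bruhat_lt (n : nat) (p s : 'S_n) : bool :=
  bruhat_le p s && (p != s).

Definition descents (n : nat) (s : 'S_n) : {set 'I_n} :=
  [set i : 'I_n | [exists j : 'I_n, (j == i.+1 :> nat) && (s j < s i)%N]]%SET.

Definition bigrassmannian (n : nat) : {set 'S_n} :=
  [set s : 'S_n | (#|descents s| == 1%N) && (#|descents (s^-1)%g| == 1%N)]%SET.

Definition alpha (n : nat) (s : 'S_n) : nat :=
  #|[set t in bigrassmannian n | bruhat_le s t]%SET|.

Definition beta (n : nat) (s : 'S_n) : nat :=
  #|[set p in bigrassmannian n | bruhat_le p s]%SET|.

Definition ksubsets (T : finType) (A : {set T}) (k : nat) : {set {set T}} :=
  [set X : {set T} | (X \subset A) && (#|X| == k)]%SET.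

Definition unif_pr (R : realType) (T : finType) (A : {set T}) (E : pred T) : R :=
  #|[set x in A | E x]%SET|%:R / #|A|%:R.

Definition unif_expect (R : realType) (T : finType) (A : {set T})
    (X : T -> R) : R :=
  (\sum_(x in A) X x) / #|A|%:R.

Definition is_star (n k l : nat)
    (t : {set 'S_n} * {set 'S_n} * {set 'S_n}) : bool :=
  let: (P, C, Q) := t in
  [&& P \subset bigrassmannian n, C \subset bigrassmannian n,
      Q \subset bigrassmannian n, #|P| == k, #|Q| == l
    & [exists r : 'S_n,
        [&& C == [set r]%SET,
            [forall p in P, bruhat_lt r p]
          & [forall s in Q, bruhat_lt s r]]]].

Definition star_pr (R : realType) (n k l : nat) : R :=
  unif_pr R
    (finset.setX (finset.setX (ksubsets (bigrassmannian n) k) (ksubsets (bigrassmannian n) 1))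
          (ksubsets (bigrassmannian n) l))
    (@is_star n k l).

Definition asymp_equiv (R : realType) (f g : nat -> R) : Prop :=
  ((fun n => f n / g n) @ \oo --> (1 : R))%classic.

(* Main.v *)
Require Import Defs.
From mathcomp Require Import zify ring.
Import Order.TTheory GRing.Theory Num.Theory.
Import numFieldNormedType.Exports.
Set Implicit Arguments.
Unset Strict Implicit.
Unset Printing Implicit Defensive.

(** A bigrassmannian permutation swaps two adjacent nonempty blocks of the
    identity, so it is given by the sizes [x, z, y, w] (in order of position) of
    its fixed prefix, of its two blocks and of its fixed suffix, with
    [x + y + z + w = n] and [y, z >= 1]. On these permutations the Bruhat order
    is coordinatewise: one goes down by enlarging [x] and [w] and shrinking [y]
    and [z]. Necessity holds because fixed prefixes, fixed suffixes and the
    bounds on [s i - i] survive reductions; sufficiency because moving one unit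
    from a block to the prefix or the suffix is a chain of reductions. Counting
    gives [alpha = (x+1)(w+1)(x+w+2)/2] and [beta = y z (y+z)/2].

    A star is a center [r] with a [k]-subset above it and an [l]-subset below
    it, which yields the exact formula. Grouping the centers by [m = x + w], the
    numerator becomes a discrete convolution of two sequences, each of which is
    itself to leading order a convolution of powers. If [a n ~ A n^p] and
    [b n ~ B n^q], then the convolution of [a] and [b] is asymptotically
    [A B p! q! / (p+q+1)! n^(p+q+1)]: this is exact up to lower order on the
    binomials ['C(n + p, p)] and ['C(n + q, q)], and the errors vanish by
    Cesaro's lemma. *)

Local Open Scope nat_scope.

(** * Bruhat order and block swaps *)

Section Bruhat.
Variable n : nat.
Implicit Types s p t : 'S_n.

Lemma reductionP s p :
  reflect (exists i j : 'I_n, [/\ i < j, s j < s i & p = (tperm i j * s)%g])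
          (reduction s p).
Proof.
apply: (iffP existsP) => [[i /existsP[j /and3P[? ? /eqP ?]]]|[i [j [? ? ->]]]].
  by exists i, j.
by exists i; apply/existsP; exists j; apply/and3P.
Qed.

Lemma bruhat_le_trans t p s : bruhat_le p t -> bruhat_le t s -> bruhat_le p s.
Proof. by move=> pt ts; apply: connect_trans ts pt. Qed.

(** Interchanging positions [i] and [j] of [s] interchanges positions [s j < s i] of the inverse. *)
Lemma reduction_inv s p : reduction s p -> reduction s^-1%g p^-1%g.
Proof.
move=> /reductionP[i [j [ij sji ->]]]; apply/reductionP.
exists (s j), (s i); rewrite !permK; split=> //.
by rewrite invMg tpermV (tpermC (s j)) -tpermJ conjgE !mulgA mulgK.
Qed.

Lemma bruhat_le_inv p s : bruhat_le p s -> bruhat_le p^-1%g s^-1%g.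
Proof.
case/connectP=> r; elim: r s => [|q r IH] s /= => [_ ->|/andP[sq qr] def_p].
  exact: connect0.
by apply: connect_trans (IH _ qr def_p); apply/connect1/reduction_inv.
Qed.

Lemma bruhat_le_ind (P : 'S_n -> Prop) :
    (forall s (i j : 'I_n), i < j -> s j < s i -> P s -> P (tperm i j * s)%g) ->
  forall p s, bruhat_le p s -> P s -> P p.
Proof.
move=> stepP p s /connectP[r].
elim: r s => [|q r IH] s /= => [_ -> //|/andP[/reductionP[i [j [ij sji ->]]]]].
by move=> pr def_p Ps; apply: IH pr def_p _; apply: stepP.
Qed.

(** The entry at [j] travels left to [i] past larger entries only, so every adjacent swap on the way
    is a reduction. Describing [k'] by its value avoids building shifted ordinals. *)
Lemma bruhat_le_move_left s p (i j : 'I_n) : i <= j ->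
    (forall k : 'I_n, i <= k < j -> s j < s k) ->
    (forall k k' : 'I_n,
       k' = (if k == i :> nat then j : nat else if i < k <= j then k.-1 else k) :> nat ->
     p k = s k') ->
  bruhat_le p s.
Proof.
case: j => j; elim: j s => [|j IH] s ltjn /= le_ij lt_s def_p.
  suff ->: p = s by apply: connect0.
  apply/permP=> k; apply: def_p; case: eqP => [->|_] /=; first by lia.
  by case: ifP => //; lia.
have [eq_ij|ne_ij] := eqVneq (i : nat) j.+1.
  suff ->: p = s by apply: connect0.
  apply/permP=> k; apply: def_p; case: eqP => [->|_] /=; first by lia.
  by case: ifP => //; lia.
pose a := Ordinal (ltnW ltjn); pose b := Ordinal ltjn.
have s_ba : s b < s a by apply: lt_s => /=; lia.
apply: (@bruhat_le_trans (tperm a b * s)%g); last first.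
  by apply: connect1; apply/reductionP; exists a, b; split=> //=.
apply: (IH _ (ltnW ltjn)) => [/=|k|k k' /=]; first by lia.
  rewrite -/a !permM tpermL /= => lt_k.
  rewrite tpermD; first by apply: lt_s; lia.
    by apply: contraTneq lt_k => <- /=; lia.
  by apply: contraTneq lt_k => <- /=; lia.
rewrite permM => def_k'; apply: def_p; move: def_k'.
case: tpermP => [->|->|/eqP + /eqP]; rewrite -?val_eqE /=; repeat case: ifP; lia.
Qed.

(** Mirror image: the entry at [i] travels right to [j] past smaller entries. *)
Lemma bruhat_le_move_right s p (i j : 'I_n) : i <= j ->
    (forall k : 'I_n, i < k <= j -> s k < s i) ->
    (forall k k' : 'I_n,
       k' = (if k == j :> nat then i : nat else if i <= k < j then k.+1 else k) :> nat ->
     p k = s k') ->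
  bruhat_le p s.
Proof.
move def_d: (j - i) => d; elim: d i def_d s => [|d IH] i def_d s le_ij lt_s def_p.
  suff ->: p = s by apply: connect0.
  apply/permP=> k; apply: def_p; case: eqP => [->|_] /=; first by lia.
  by case: ifP => //; lia.
have lt_in : i.+1 < n by move: (ltn_ord j); lia.
pose b := Ordinal lt_in.
have s_bi : s b < s i by apply: lt_s => /=; lia.
apply: (@bruhat_le_trans (tperm i b * s)%g); last first.
  by apply: connect1; apply/reductionP; exists i, b; split=> //=.
apply: (IH b) => [/=|/=|k|k k' /=]; [lia|lia| |].
  rewrite !permM tpermR /= => lt_k.
  rewrite tpermD; first by apply: lt_s; lia.
    by apply: contraTneq lt_k => <- /=; lia.
  by apply: contraTneq lt_k => <- /=; lia.
rewrite permM => def_k'; apply: def_p; move: def_k'.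
case: tpermP => [->|->|/eqP + /eqP]; rewrite -?val_eqE /=; repeat case: ifP; lia.
Qed.

End Bruhat.

(** The first [z] moved positions carry the upper values and the next [y] the lower ones. Hence, for
    nonempty blocks, [y] is the largest excess of a value over its position and [z] the largest
    defect. *)
Definition block_swap (x y z i : nat) : nat :=
  if i < x then i else if i < x + z then i + y
  else if i < x + y + z then i - z else i.

Definition is_block_swap (n x y z : nat) (s : 'S_n) : Prop :=
  forall i : 'I_n, s i = block_swap x y z i :> nat.

Section BlockSwap.
Variable n : nat.
Implicit Types s p : 'S_n.

Lemma block_swap_lt x y z i : x + y + z <= n -> i < n -> block_swap x y z i < n.
Proof. by rewrite /block_swap; repeat case: ifP; lia. Qed.

Lemma block_swapK x y z : cancel (block_swap x y z) (block_swap x z y).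
Proof. by move=> i; rewrite /block_swap; repeat case: ifP; lia. Qed.

Lemma ex_block_swap x y z : x + y + z <= n -> exists s, is_block_swap x y z s.
Proof.
move=> le_n; pose f (i : 'I_n) := Ordinal (block_swap_lt le_n (ltn_ord i)).
have f_inj : injective f.
  by move=> i j [/(can_inj (@block_swapK x y z))/val_inj].
by exists (perm f_inj) => i; rewrite permE.
Qed.

Lemma is_block_swap_inj x y z s p :
  is_block_swap x y z s -> is_block_swap x y z p -> s = p.
Proof. by move=> ss sp; apply/permP=> i; apply/val_inj; rewrite /= ss sp. Qed.

Lemma is_block_swap_inv x y z s :
  is_block_swap x y z s -> is_block_swap x z y s^-1%g.
Proof.
by move=> ss i; rewrite -[in RHS](permKV s i) ss block_swapK.
Qed.

(** The smallest moved value [x], at position [x + z], travels left past the whole upper block and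
    joins the fixed prefix. *)
Lemma bruhat_le_block_swap_left x y z s p :
    is_block_swap x y.+1 z s -> is_block_swap x.+1 y z p -> x + y.+1 + z <= n ->
  bruhat_le p s.
Proof.
move=> ss sp le_n.
have lt_i : x < n by lia.
have lt_j : x + z < n by lia.
apply: (@bruhat_le_move_left _ _ _ (Ordinal lt_i) (Ordinal lt_j)) => /=; first by lia.
  by move=> k; rewrite !ss /= /block_swap; repeat case: ifP; lia.
move=> k k' def_k'; apply: val_inj; rewrite /= ss sp def_k' /block_swap.
by repeat case: ifP; lia.
Qed.

(** The largest moved value, at position [x + z], travels right past the whole lower block and joins
    the fixed suffix. *)
Lemma bruhat_le_block_swap_right x y z s p :
    is_block_swap x y z.+1 s -> is_block_swap x y z p -> x + y + z.+1 <= n ->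
  bruhat_le p s.
Proof.
move=> ss sp le_n.
have lt_i : x + z < n by lia.
have lt_j : x + z + y < n by lia.
apply: (@bruhat_le_move_right _ _ _ (Ordinal lt_i) (Ordinal lt_j)) => /=; first by lia.
  by move=> k; rewrite !ss /= /block_swap; repeat case: ifP; lia.
move=> k k' def_k'; apply: val_inj; rewrite /= ss sp def_k' /block_swap.
by repeat case: ifP; lia.
Qed.

(** Induction on the total excess of block sizes: a block that is still too large gives one unit to
    the prefix while that is too short, and otherwise to the suffix. *)
Lemma bruhat_le_block_swap x y z x' y' z' s p :
    is_block_swap x' y' z' s -> is_block_swap x y z p -> x' + y' + z' <= n ->
    x' <= x -> y <= y' -> z <= z' -> x + y + z <= x' + y' + z' ->
  bruhat_le p s.
Proof.
move def_d: (y' + z' - (y + z)) => d.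
elim: d x' y' z' def_d s => [|d IH] x' y' z' def_d s ss sp le_n lex ley lez lew.
  have [ex [ey ez]] : x' = x /\ y' = y /\ z' = z by lia.
  move: ss; rewrite ex ey ez => ss.
  by rewrite (is_block_swap_inj sp ss); apply: connect0.
suff [x1 [y1 [z1 [t [st e1 [e2 e3 e4] e5 le_ts]]]]] : exists x1 y1 z1 t,
  [/\ is_block_swap x1 y1 z1 t, y1 + z1 = y + z + d,
      [/\ x1 <= x, y <= y1 & z <= z1], x + y + z <= x1 + y1 + z1 <= n
    & bruhat_le t s].
  by apply: bruhat_le_trans le_ts; apply: (IH x1 y1 z1) => //; lia.
have [lt_y|ge_y] := ltnP y y'.
  case: y' lt_y def_d ss le_n ley lew => // y' lt_y def_d ss le_n ley lew.
  have [lt_x|ge_x] := ltnP x' x.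
    have [t st] := @ex_block_swap x'.+1 y' z' ltac:(lia).
    exists x'.+1, y', z', t; split; [by []|lia|by split; lia|lia|].
    exact: bruhat_le_block_swap_left ss st le_n.
  have [t st] := @ex_block_swap x' y' z' ltac:(lia).
  exists x', y', z', t; split; [by []|lia|by split; lia|lia|].
  (* Inversion exchanges the two blocks, so the move that shrinks [z] also serves for [y]. *)
  rewrite -(invgK t) -(invgK s); apply: bruhat_le_inv.
  by apply: bruhat_le_block_swap_right (is_block_swap_inv ss) (is_block_swap_inv st) _; lia.
case: z' def_d ss le_n lez lew => [|z'] def_d ss le_n lez lew; first by lia.
have [lt_x|ge_x] := ltnP x' x.
  have [t st] := @ex_block_swap x'.+1 y' z' ltac:(lia).
  exists x'.+1, y', z', t; split; [by []|lia|by split; lia|lia|].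
  rewrite -(invgK t) -(invgK s); apply: bruhat_le_inv.
  by apply: bruhat_le_block_swap_left (is_block_swap_inv ss) (is_block_swap_inv st) _; lia.
have [t st] := @ex_block_swap x' y' z' ltac:(lia).
exists x', y', z', t; split; [by []|lia|by split; lia|lia|].
exact: bruhat_le_block_swap_right ss st le_n.
Qed.

(** After a reduction, [i] holds [s j < s i] and [j > i] holds [s i]; both stay within the bound on
    [s i]. *)
Lemma bruhat_le_excess m p s :
  bruhat_le p s -> (forall k : 'I_n, s k <= k + m) -> forall k : 'I_n, p k <= k + m.
Proof.
apply: (bruhat_le_ind (P := fun t : 'S_n => forall k : 'I_n, t k <= k + m)).
move=> {}s i j lt_ij lt_s le_s k; rewrite permM.
by case: tpermP => [->|->|_ _] //; move: (le_s i); lia.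
Qed.

Lemma bruhat_le_defect m p s :
  bruhat_le p s -> (forall k : 'I_n, k <= s k + m) -> forall k : 'I_n, k <= p k + m.
Proof.
apply: (bruhat_le_ind (P := fun t : 'S_n => forall k : 'I_n, k <= t k + m)).
move=> {}s i j lt_ij lt_s le_s k; rewrite permM.
by case: tpermP => [->|->|_ _] //; move: (le_s j); lia.
Qed.

(** No reduction can touch the prefix: if [i < m], then [s j < s i = i] is itself a fixed point, so
    [s j = j] by injectivity, against [i < j]. *)
Lemma bruhat_le_fix_prefix m p s : bruhat_le p s ->
  (forall k : 'I_n, k < m -> s k = k) -> forall k : 'I_n, k < m -> p k = k.
Proof.
apply: (bruhat_le_ind (P := fun t : 'S_n => forall k : 'I_n, k < m -> t k = k)).
move=> {}s i j lt_ij lt_s fix_s.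
have le_mi : m <= i.
  rewrite leqNgt; apply/negP=> lt_im; move: (lt_s); rewrite (fix_s i) // => lt_ji.
  have /perm_inj ej := fix_s (s j) (ltn_trans lt_ji lt_im).
  by rewrite ej in lt_ji; lia.
move=> k lt_km; rewrite permM tpermD ?fix_s //.
  by apply: contraTneq lt_km => <-; lia.
by apply: contraTneq lt_km => <-; lia.
Qed.

Lemma bruhat_le_fix_suffix m p s : bruhat_le p s ->
  (forall k : 'I_n, m <= k -> s k = k) -> forall k : 'I_n, m <= k -> p k = k.
Proof.
apply: (bruhat_le_ind (P := fun t : 'S_n => forall k : 'I_n, m <= k -> t k = k)).
move=> {}s i j lt_ij lt_s fix_s.
have lt_jm : j < m.
  rewrite ltnNge; apply/negP=> le_mj; move: (lt_s); rewrite (fix_s j) // => lt_ji.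
  have /perm_inj ej := fix_s (s i) (leq_trans le_mj (ltnW lt_ji)).
  by rewrite ej in lt_ji; lia.
move=> k le_mk; rewrite permM tpermD ?fix_s //.
  by apply: contraTneq le_mk => <-; lia.
by apply: contraTneq le_mk => <-; lia.
Qed.

Lemma bruhat_le_block_swapE x y z x' y' z' s p :
    is_block_swap x' y' z' s -> is_block_swap x y z p ->
    x' + y' + z' <= n -> x + y + z <= n -> 0 < y -> 0 < z -> 
  bruhat_le p s = [&& x' <= x, y <= y', z <= z' & x + y + z <= x' + y' + z'].
Proof.
move=> ss sp le_n' le_n y_gt0 z_gt0; apply/idP/idP => [le_ps|/and4P[*]]; last first.
  exact: bruhat_le_block_swap ss sp _ _ _ _ _.
(* The test positions for [p]: [x] is its first moved point and has excess [y], [x + z] has defect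
   [z], and the third is its last moved point. *)
have lt1 : x < n by lia.
have lt2 : x + z < n by lia.
have lt3 : (x + y + z).-1 < n by lia.
apply/and4P; split.
- rewrite leqNgt; apply/negP=> lt_xx'.
  have := @bruhat_le_fix_prefix x' _ _ le_ps _ (Ordinal lt1) lt_xx'.
  have fix_s (k : 'I_n) : k < x' -> s k = k.
    by move=> lt_k; apply: val_inj; rewrite /= ss /block_swap lt_k.
  move=> /(_ fix_s) /(congr1 val); rewrite /= sp /= /block_swap.
  by repeat case: ifP; lia.
- have := @bruhat_le_excess y' _ _ le_ps _ (Ordinal lt1).
  rewrite sp /=; have le_s (k : 'I_n) : s k <= k + y'.
    by rewrite ss /block_swap; repeat case: ifP; lia.
  by move=> /(_ le_s); rewrite /block_swap; repeat case: ifP; lia.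
- have := @bruhat_le_defect z' _ _ le_ps _ (Ordinal lt2).
  rewrite sp /=; have le_s (k : 'I_n) : k <= s k + z'.
    by rewrite ss /block_swap; repeat case: ifP; lia.
  by move=> /(_ le_s); rewrite /block_swap; repeat case: ifP; lia.
rewrite leqNgt; apply/negP=> lt_w.
have := @bruhat_le_fix_suffix (x' + y' + z') _ _ le_ps _ (Ordinal lt3).
have fix_s (k : 'I_n) : x' + y' + z' <= k -> s k = k.
  by move=> lt_k; apply: val_inj; rewrite /= ss /block_swap; repeat case: ifP; lia.
move=> /(_ fix_s) /=; rewrite -[_ <= _]/(_ <= _) => /(_ ltac:(lia)) /(congr1 val).
by rewrite /= sp /= /block_swap; repeat case: ifP; lia.
Qed.

End BlockSwap.

(** * Bigrassmannian permutations *)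

Section Bigrassmannian.
Variable n : nat.
Implicit Types s p : 'S_n.

Lemma descentsP s (i : 'I_n) :
  reflect (exists2 j : 'I_n, j = i.+1 :> nat & s j < s i) (i \in descents s).
Proof.
rewrite inE; apply: (iffP existsP) => [[j /andP[/eqP ? ?]]|[j ? ?]]; exists j => //.
by apply/andP; split=> //; apply/eqP.
Qed.

Lemma card_descents_block_swap x y z s :
    is_block_swap x y z s -> x + y + z <= n -> 0 < y -> 0 < z ->
  #|descents s| = 1.
Proof.
move=> ss le_n y_gt0 z_gt0.
have lt_n : (x + z).-1 < n by lia.
suff -> : descents s = [set Ordinal lt_n]%SET by rewrite cards1.
apply/finset.setP=> i; rewrite finset.in_set1 -val_eqE /=; apply/descentsP/eqP => [[j ej]|ei].
  by rewrite !ss ej /block_swap; repeat case: ifP; lia.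
have lt_j : x + z < n by lia.
by exists (Ordinal lt_j) => /=; rewrite ?ss /= ?ei /block_swap; repeat case: ifP; lia.
Qed.

Lemma block_swap_bigrassmannian x y z s :
    is_block_swap x y z s -> x + y + z <= n -> 0 < y -> 0 < z ->
  s \in bigrassmannian n.
Proof.
move=> ss le_n y_gt0 z_gt0; rewrite inE (card_descents_block_swap ss) //.
by rewrite (card_descents_block_swap (is_block_swap_inv ss)) //; lia.
Qed.

(** On either side of its only descent [s] is strictly increasing, so it gains at least one per
    step. *)
Lemma single_descent_growth s (d i j : 'I_n) :
    #|descents s| = 1 -> d \in descents s -> i <= j ->
    (j <= d) || (d < i) -> s i + (j - i) <= s j.
Proof.
move=> /eqP/cards1P[d' def_s] d_s; have {d' def_s d_s} def_s : descents s = [set d]%SET.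
  by move: d_s; rewrite def_s finset.in_set1 => /eqP->.
case: j => j; elim: j => [|j IH] lt_jn /= le_ij dPj.
  by rewrite (_ : i = Ordinal lt_jn) ?subn0 ?addn0 //; apply/val_inj => /=; lia.
have [eq_ij|ne_ij] := eqVneq (i : nat) j.+1.
  by rewrite (_ : i = Ordinal lt_jn) ?subnn ?addn0 //; apply/val_inj.
have /= := IH (ltnW lt_jn) ltac:(rewrite /=; lia) ltac:(rewrite /=; lia).
have : Ordinal (ltnW lt_jn) \notin descents s.
  by rewrite def_s finset.in_set1 -val_eqE /=; lia.
move=> /descentsP no_desc.
have lt_s : s (Ordinal (ltnW lt_jn)) <= s (Ordinal lt_jn).
  by rewrite leqNgt; apply/negP=> lt_s; apply: no_desc; exists (Ordinal lt_jn).
have ne_s : s (Ordinal (ltnW lt_jn)) != s (Ordinal lt_jn) :> nat.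
  by apply/eqP=> /val_inj/perm_inj/(congr1 val) /=; lia.
by rewrite /=; lia.
Qed.

(* With [x] the first non-fixed point, the descent of [s] is just before the
   position of the value [x] and the descent of the inverse of [s] is just below
   the value [s x]; the two growth bounds then pin every entry from both sides. *)
Lemma bigrassmannian_block_swap s : s \in bigrassmannian n ->
  exists x y z, [/\ 0 < y, 0 < z, x + y + z <= n & is_block_swap x y z s].
Proof.
rewrite inE => /andP[/eqP s1 /eqP t1]; set t := s^-1%g in t1.
have tK i : t (s i) = i by rewrite permK.
have sK i : s (t i) = i by rewrite permKV.
have exP : exists k, [exists i : 'I_n, (i == k :> nat) && (s i != i)].
  have /card_gt0P[i /descentsP[j ej lt_ji]] : 0 < #|descents s| by rewrite s1.
  have [fi|ni] := eqVneq (s i) i; last first.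
    by exists i; apply/existsP; exists i; rewrite eqxx.
  exists j; apply/existsP; exists j; rewrite eqxx /=.
  by apply: contraTneq lt_ji => ->; rewrite fi; lia.
case: (ex_minnP exP) => k /existsP[x /andP[/eqP ek nx]] minx.
rewrite -{}ek {k exP} in minx.
have fix_s (i : 'I_n) : i < x -> s i = i.
  move=> lt_ix; apply/eqP/negPn/negP=> ni.
  have := minx i ltac:(by apply/existsP; exists i; rewrite eqxx).
  by lia.
have fix_t (i : 'I_n) : i < x -> t i = i by move=> /fix_s {1}<-; rewrite tK.
have ge_s (i : 'I_n) : x <= i -> x <= s i.
  move=> le_xi; rewrite leqNgt; apply/negP=> lt; have := fix_t _ lt.
  by rewrite tK => e; rewrite -e in lt; lia.
have ge_t (i : 'I_n) : x <= i -> x <= t i.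
  move=> le_xi; rewrite leqNgt; apply/negP=> lt; have := fix_s _ lt.
  by rewrite sK => e; rewrite -e in lt; lia.
have gt_sx : x < s x.
  have : s x <> x :> nat by move/val_inj/eqP; rewrite (negbTE nx).
  by have := ge_s x (leqnn x); lia.
have gt_tx : x < t x.
  have : t x <> x :> nat by move/val_inj => e; move: nx; rewrite -{1}e sK eqxx.
  by have := ge_t x (leqnn x); lia.
have lt_d : (t x).-1 < n by move: (ltn_ord (t x)); lia.
have lt_e : (s x).-1 < n by move: (ltn_ord (s x)); lia.
pose d := Ordinal lt_d; pose e := Ordinal lt_e.
have ds : d \in descents s.
  apply/descentsP; exists (t x); rewrite /= ?sK; first by lia.
  have : s d <> x :> nat by move=> /val_inj/(congr1 t); rewrite tK => /(congr1 val) /=; lia.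
  by have := ge_s d ltac:(rewrite /=; lia); lia.
have et : e \in descents t.
  apply/descentsP; exists (s x); rewrite /= ?tK; first by lia.
  have : t e <> x :> nat by move=> /val_inj/(congr1 s); rewrite sK => /(congr1 val) /=; lia.
  by have := ge_t e ltac:(rewrite /=; lia); lia.
have gs i j := single_descent_growth (i := i) (j := j) s1 ds.
have gt i j := single_descent_growth (i := i) (j := j) t1 et.
(* In a block swap starting at [x], position [x] holds [x + y] and the value [x] sits at position
   [x + z]. *)
exists x, (s x - x), (t x - x).
have blockB (i : 'I_n) : x <= i < t x -> s i = i + (s x - x) :> nat.
  move=> lt_i; have := gs x i ltac:(lia) ltac:(rewrite /=; lia) => le1.
  have := gt (s x) (s i) ltac:(lia) ltac:(rewrite /=; lia).
  by rewrite !tK; lia.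
have blockA (v : 'I_n) : x <= v < s x -> t v = v + (t x - x) :> nat.
  move=> lt_v; have := gt x v ltac:(lia) ltac:(rewrite /=; lia) => le1.
  have := gs (t x) (t v) ltac:(lia) ltac:(rewrite /=; lia).
  by rewrite !sK; lia.
have le_n : s x + (t x - x) <= n.
  by have := blockA e ltac:(rewrite /=; lia); have := ltn_ord (t e); rewrite /=; lia.
split; [lia|lia|lia|].
pose q := s x + (t x - x).
(* All values below [q] are taken by positions below [q]: the prefix, then [blockA] for values below
   [s x], then [blockB]. *)
have ge_sq (i : 'I_n) : q <= i -> q <= s i.
  rewrite /q => le_qi; rewrite leqNgt; apply/negP=> lt_q.
  have [lt_v|ge_v] := ltnP (s i) (s x).
    by have := blockA (s i); rewrite tK; move: (ge_s i); lia.
  have lt_w : s i - (s x - x) < n by move: (ltn_ord (s i)); lia.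
  have /= ew := blockB (Ordinal lt_w) ltac:(rewrite /=; lia).
  have /(congr1 t) : s (Ordinal lt_w) = s i by apply: val_inj; rewrite /= ew; lia.
  by rewrite !tK => /(congr1 val) /=; lia.
have ge_tq (v : 'I_n) : q <= v -> q <= t v.
  rewrite /q => le_qv; rewrite leqNgt; apply/negP=> lt_q.
  have [lt_i|ge_i] := ltnP (t v) (t x).
    by have := blockB (t v); rewrite sK; move: (ge_t v); lia.
  have lt_w : t v - (t x - x) < n by move: (ltn_ord (t v)); lia.
  have /= ew := blockA (Ordinal lt_w) ltac:(rewrite /=; lia).
  have /(congr1 s) : t (Ordinal lt_w) = t v by apply: val_inj; rewrite /= ew; lia.
  by rewrite !sK => /(congr1 val) /=; lia.
(* Growth from [q] gives [i <= s i], and the same argument for [t] gives [s i <= i]. *)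
have tail (i : 'I_n) : q <= i -> s i = i :> nat.
  move=> le_qi; have lt_q : q < n by move: (ltn_ord i); lia.
  have := gs (Ordinal lt_q) i le_qi ltac:(rewrite /= /q; lia).
  have := ge_sq (Ordinal lt_q) (leqnn _) => /= le1 le2.
  have := gt (Ordinal lt_q) (s i) ltac:(rewrite /=; lia) ltac:(rewrite /= /q; lia).
  by have := ge_tq (Ordinal lt_q) (leqnn _); rewrite tK /=; lia.
move=> i; rewrite /block_swap; case: ifP => [/fix_s -> //|ge_x].
case: ifP => [lt_i|ge_i]; first by apply: blockB; lia.
case: ifP => [lt_i2|ge_i2]; last by apply: tail; rewrite /q; lia.
have lt_v : i - (t x - x) < n by move: (ltn_ord i); lia.
have /= ev := blockA (Ordinal lt_v) ltac:(rewrite /=; lia).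
have e_i : t (Ordinal lt_v) = i by apply: val_inj; rewrite /= ev; lia.
by rewrite -{1}e_i sK.
Qed.
End Bigrassmannian.

(** * Counting *)

(* [alpha] of a block swap with [i] leading and [w] trailing fixed points, and
   [beta] of one with blocks of sizes [i + 1] and [w + 1]. *)
Definition half_prism (i w : nat) : nat := (i.+1 * w.+1 * (i + w).+2)./2.

Arguments half_prism : simpl never.

(** Sums the choices of [k] elements above over all splittings of [m] fixed points into prefix and
    suffix; dually, the choices below over all splittings into two blocks. *)
Definition half_prism_bin_sum (k m : nat) : nat :=
  \sum_(i < m.+1) 'C((half_prism i (m - i)).-1, k).

(** Pairing [(a, b)] with [(i - a, w - b)] makes every pair of terms add up to [(i + w).+2]. *)
Lemma sum_half_prism i w :
  \sum_(a < i.+1) \sum_(b < w.+1) (i + w - (a + b)).+1 = half_prism i w.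
Proof.
pose F a b := (i + w - (a + b)).+1; pose S := \sum_(a < i.+1) \sum_(b < w.+1) F a b.
suff: S + S = i.+1 * w.+1 * (i + w).+2.
  by rewrite /half_prism -/S => <-; rewrite addnn doubleK.
rewrite {1}/S (reindex_inj rev_ord_inj) -big_split /=.
rewrite (eq_bigr (fun=> w.+1 * (i + w).+2)) => [|a _].
  by rewrite sum_nat_const card_ord mulnA.
rewrite (reindex_inj rev_ord_inj) -big_split /=.
rewrite (eq_bigr (fun=> (i + w).+2)) => [|b _].
  by rewrite sum_nat_const card_ord.
by rewrite /F; move: (ltn_ord a) (ltn_ord b); lia.
Qed.

Lemma sum_ord_interval (F : nat -> nat) (M a b : nat) : a + b <= M ->
  \sum_(k < M.+1) (a <= k <= a + b) * F k = \sum_(k < b.+1) F (a + k).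
Proof.
move=> le_M; rewrite -(big_mkord xpredT (fun k => (a <= k <= a + b) * F k)).
rewrite (@big_cat_nat _ _ _ a) //=; last by lia.
rewrite (@big_cat_nat _ _ _ (a + b).+1 a) //=; last lia.
rewrite big_nat big1 => [|k lt_k]; last by case: leqP; rewrite ?mul0n //; lia.
rewrite [X in _ + (_ + X)]big_nat [X in _ + (_ + X)]big1 => [|k lt_k]; last first.
  by rewrite (_ : (k <= a + b) = false) ?andbF //; lia.
rewrite add0n addn0 -{1}(add0n a) big_addn (_ : (a + b).+1 - a = b.+1) ?big_mkord; last lia.
apply: eq_bigr => k _.
by rewrite (_ : a <= k + a <= a + b) ?mul1n 1?addnC //; move: (ltn_ord k); lia.
Qed.

(** * Coordinates on bigrassmannian permutations *)

Section Parametrization.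
Variable N : nat.
Let T : finType := ('I_N.+1 * 'I_N.+1 * 'I_N.+1)%type.
Implicit Types t : T.

(* [(m, i, j)] encodes the block swap with [i] leading fixed points, [m - i]
   trailing ones, and blocks of sizes [j + 1] and [N - m - j + 1]. *)
Definition bigr_param : {set T} :=
  [set t : T | (t.1.2 <= t.1.1) && (t.2 <= N - t.1.1)]%SET.

(** The default [1%g] is never reached on [bigr_param]. The size is [N.+2] because the two nonempty
    blocks take up at least two points. *)
Definition bigr_of t : 'S_N.+2 :=
  xget 1%g (is_block_swap t.1.2 t.2.+1 (N - t.1.1 - t.2).+1).

(* Exchanges the fixed margins with the blocks (minus one each); it reverses the
   order, so that [beta] follows from [alpha]. *)
Definition bigr_dual t : T := (rev_ord t.1.1, t.2, t.1.2).

Lemma bigr_ofP t : t \in bigr_param ->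
  is_block_swap t.1.2 t.2.+1 (N - t.1.1 - t.2).+1 (bigr_of t).
Proof.
rewrite inE => /andP[le1 le2]; rewrite /bigr_of.
by apply: xgetPex; apply: ex_block_swap; move: (ltn_ord t.1.1); lia.
Qed.

Lemma bruhat_le_bigr_of t t' : t \in bigr_param -> t' \in bigr_param ->
  bruhat_le (bigr_of t) (bigr_of t') =
  [&& t'.1.2 <= t.1.2, t'.1.1 - t'.1.2 <= t.1.1 - t.1.2, t.2 <= t'.2
    & N - t.1.1 - t.2 <= N - t'.1.1 - t'.2].
Proof.
move=> Dt Dt'; rewrite (bruhat_le_block_swapE (bigr_ofP Dt') (bigr_ofP Dt)) //.
- move: Dt Dt'; rewrite !inE; have := ltn_ord t.1.1; have := ltn_ord t'.1.1.
  by move: t t' => [[m i] j] [[m' i'] j'] /=; lia.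
- by move: Dt'; rewrite inE; have := ltn_ord t'.1.1; lia.
- by move: Dt; rewrite inE; have := ltn_ord t.1.1; lia.
Qed.

(** Equal permutations lie below each other, and the coordinatewise inequalities in both directions
    force equal parameters. *)
Lemma bigr_of_inj : {in bigr_param &, injective bigr_of}.
Proof.
move=> t t' Dt Dt' eq_tt'.
have le1 : bruhat_le (bigr_of t) (bigr_of t') by rewrite eq_tt'; apply: connect0.
have le2 : bruhat_le (bigr_of t') (bigr_of t) by rewrite eq_tt'; apply: connect0.
move: le1 le2 (Dt) (Dt'); rewrite !bruhat_le_bigr_of // !inE {eq_tt'}.
move: t t' {Dt Dt'} => [[m i] j] [[m' i'] j'] /= le1 le2 D1 D2.
have [em ei ej] : [/\ m = m' :> nat, i = i' :> nat & j = j' :> nat].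
  by have := ltn_ord m; have := ltn_ord m'; split; lia.
by rewrite (val_inj em) (val_inj ei) (val_inj ej).
Qed.

Lemma bigrassmannianE : bigrassmannian N.+2 = (bigr_of @: bigr_param)%SET.
Proof.
apply/finset.setP=> s; apply/idP/imsetP => [|[t Dt ->]]; last first.
  apply: (block_swap_bigrassmannian (bigr_ofP Dt)) => //.
  by move: Dt; rewrite inE; have := ltn_ord t.1.1; lia.
case/bigrassmannian_block_swap=> x [y [z [y_gt0 z_gt0 le_n ss]]].
have lt_m : N - (y.-1 + z.-1) < N.+1 by lia.
have lt_i : x < N.+1 by lia.
have lt_j : y.-1 < N.+1 by lia.
pose t : T := (Ordinal lt_m, Ordinal lt_i, Ordinal lt_j).
have Dt : t \in bigr_param by rewrite inE /=; lia.
exists t => //; apply: is_block_swap_inj ss _; have := bigr_ofP Dt => /=.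
by rewrite (_ : (y.-1).+1 = y) 1?(_ : (N - _ - _).+1 = z) //; lia.
Qed.

Lemma sum_bigrassmannian (V : nmodType) (F : 'S_N.+2 -> V) :
  (\sum_(s in bigrassmannian N.+2) F s = \sum_(t in bigr_param) F (bigr_of t))%R.
Proof. by rewrite bigrassmannianE big_imset //; apply: bigr_of_inj. Qed.

Lemma sum_bigr_param (V : nmodType) (F : T -> V) :
  (\sum_(t in bigr_param) F t =
   \sum_(m < N.+1) \sum_(i < N.+1 | (i <= m)%N)
     \sum_(j < N.+1 | (j <= N - m)%N) F (m, i, j))%R.
Proof.
under [RHS]eq_bigr => m _ do rewrite pair_big_dep.
rewrite pair_big_dep
  (reindex (fun p : 'I_N.+1 * ('I_N.+1 * 'I_N.+1) => (p.1, p.2.1, p.2.2))) /=.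
  by apply: eq_bigl => p; rewrite inE.
by exists (fun t => (t.1.1, (t.1.2, t.2))) => [[? []]|[[]]].
Qed.

Lemma bigr_dual_param t : (bigr_dual t \in bigr_param) = (t \in bigr_param).
Proof.
by case: t => [[m i] j]; rewrite !inE /=; move: (ltn_ord m); case: (j <= N - m) /idP; lia.
Qed.

Lemma bigr_dualK : involutive bigr_dual.
Proof. by case=> [[m i] j]; rewrite /bigr_dual /= rev_ordK. Qed.

(** Order reversal, with one dual on each side: the form needed once the sum for [beta] is reindexed
    by [bigr_dual]. *)
Lemma bruhat_le_bigr_dual t t' : t \in bigr_param -> t' \in bigr_param ->
  bruhat_le (bigr_of (bigr_dual t)) (bigr_of t') =
  bruhat_le (bigr_of (bigr_dual t')) (bigr_of t).
Proof.
move=> Dt Dt'; rewrite !bruhat_le_bigr_of ?bigr_dual_param //=.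
move: t t' Dt Dt' => [[m i] j] [[m' i'] j']; rewrite !inE /= => /andP[? ?] /andP[? ?].
have := ltn_ord m; have := ltn_ord m' => ? ?.
by apply/and4P/and4P => -[? ? ? ?]; split; lia.
Qed.

Lemma alphaE n (s : 'S_n) : alpha s = \sum_(p in bigrassmannian n) bruhat_le s p.
Proof.
rewrite /alpha -sum1_card (eq_bigl (fun p => (p \in bigrassmannian n) && bruhat_le s p)).
  by rewrite big_mkcondr.
by move=> p; rewrite !inE.
Qed.

Lemma betaE n (s : 'S_n) : beta s = \sum_(p in bigrassmannian n) bruhat_le p s.
Proof.
rewrite /beta -sum1_card (eq_bigl (fun p => (p \in bigrassmannian n) && bruhat_le p s)).
  by rewrite big_mkcondr.
by move=> p; rewrite !inE.
Qed.

Lemma alpha_bigr_of t : t \in bigr_param ->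
  alpha (bigr_of t) = half_prism t.1.2 (t.1.1 - t.1.2).
Proof.
case: t => [[m i] j] Dt /=; rewrite alphaE sum_bigrassmannian.
rewrite -sum_half_prism.
transitivity (\sum_(t' in bigr_param)
  [&& t'.1.2 <= i, t'.1.1 - t'.1.2 <= m - i, j <= t'.2
    & N - m - j <= N - t'.1.1 - t'.2]).
  by apply: eq_bigr => t' Dt'; rewrite bruhat_le_bigr_of.
rewrite sum_bigr_param /=; move: Dt; rewrite inE /= => Dt.
have lt_m := ltn_ord m.
(* For given [m'] and [i'], the last two order conditions read [j <= j' <= j + (m - m')], which
   leaves [(m - m').+1] choices of [j']. Writing [m' = i' + b] then gives the sum of
   [sum_half_prism]. *)
pose G m' i' := (i' <= m' <= i' + (m - i)) * (m - m').+1.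
transitivity (\sum_(m' < N.+1) \sum_(i' < N.+1) (0 <= i' <= 0 + i) * G m' i').
  apply: eq_bigr => m' _; rewrite big_mkcond; apply: eq_bigr => i' _ /=.
  rewrite big_mkcond /= /G ?add0n /=.
  case: (leqP i' m') => le_i'm'; last by rewrite /= muln0.
  case: (leqP i' i) => le_i'i; last first.
    by rewrite big1 // => j' _; rewrite if_same.
  rewrite mul1n; case: (leqP m' (i' + (m - i))) => le_m'; last first.
    rewrite big1 // => j' _.
    by case: ifP => // _; rewrite (_ : (_ <= m - i) = false) //; lia.
  transitivity (\sum_(j' < N.+1) (j <= j' <= j + (m - m')) * 1).
    apply: eq_bigr => j' _; move: (ltn_ord j') (ltn_ord m') => lt_j' lt_m'.
    case: ifP => le_j'; rewrite muln1; first by congr nat_of_bool; lia.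
    by rewrite (_ : _ && _ = false) //; lia.
  rewrite (sum_ord_interval (fun=> 1)); last by lia.
  by rewrite sum1_card card_ord mul1n.
rewrite exchange_big /=.
transitivity (\sum_(i' < N.+1) (0 <= i' <= 0 + i) * \sum_(b < (m - i).+1) (m - (i' + b)).+1).
  apply: eq_bigr => i' _; rewrite -big_distrr /=; case: leqP => le_i'; rewrite ?mul0n //.
  by rewrite !mul1n /G (sum_ord_interval (fun m' => (m - m').+1)) //; lia.
rewrite (sum_ord_interval (fun i' => \sum_(b < (m - i).+1) (m - (i' + b)).+1)); last by lia.
by apply: eq_bigr => a _; apply: eq_bigr => b _; rewrite add0n subnKC //; lia.
Qed.

Lemma beta_bigr_of t : t \in bigr_param ->
  beta (bigr_of t) = half_prism t.2 (N - t.1.1 - t.2).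
Proof.
move=> Dt; have := @alpha_bigr_of (bigr_dual t).
rewrite bigr_dual_param /= subSS => /(_ Dt) <-.
rewrite alphaE betaE !sum_bigrassmannian (reindex_inj (inv_inj bigr_dualK)) /=.
rewrite (eq_bigl (mem bigr_param)); last by move=> t'; rewrite /= bigr_dual_param.
by apply: eq_bigr => t' Dt'; rewrite bruhat_le_bigr_dual.
Qed.

(** For fixed [m], [alpha] depends only on [i] and [beta] only on [j], so the inner double sum
    factors. *)
Lemma sum_bin_alpha_beta k l :
  \sum_(s in bigrassmannian N.+2) 'C((alpha s).-1, k) * 'C((beta s).-1, l) =
  \sum_(m < N.+1) half_prism_bin_sum k m * half_prism_bin_sum l (N - m).
Proof.
rewrite sum_bigrassmannian.
transitivity (\sum_(t in bigr_param) 'C((half_prism t.1.2 (t.1.1 - t.1.2)).-1, k) *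
   'C((half_prism t.2 (N - t.1.1 - t.2)).-1, l)).
  by apply: eq_bigr => t Dt; rewrite alpha_bigr_of // beta_bigr_of.
rewrite sum_bigr_param; apply: eq_bigr => m _ /=.
rewrite /half_prism_bin_sum big_distrl /=.
rewrite (big_ord_widen N.+1 (fun i => 'C((half_prism i (m - i)).-1, k) * _)) //=.
apply: eq_bigr => i _; rewrite -big_distrr /=; congr (_ * _).
by rewrite (big_ord_widen N.+1 (fun j => 'C((half_prism j (N - m - j)).-1, l)))
  // ltnS leq_subr.
Qed.

End Parametrization.

Lemma card_ksubsets (T : finType) (A : {set T}) k : #|ksubsets A k| = 'C(#|A|, k).
Proof. exact: cards_draws. Qed.

Lemma ksubsets1 (T : finType) (A : {set T}) :
  ksubsets A 1 = [set [set x]%SET | x in A]%SET.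
Proof.
apply/finset.setP=> B; rewrite inE; apply/andP/imsetP => [[sBA /cards1P[x def_B]]|[x Ax ->]].
  by exists x => //; move: sBA; rewrite def_B finset.sub1set.
by rewrite finset.sub1set cards1.
Qed.

(** * Counting stars by their center *)

Section Stars.
Variable n : nat.
Local Notation B := (bigrassmannian n).
Implicit Types r s : 'S_n.

Lemma card_bruhat_gt r : r \in B -> #|[set t in B | bruhat_lt r t]%SET| = (alpha r).-1.
Proof.
move=> Br; rewrite /alpha [X in _ = X.-1](cardsD1 r).
rewrite (_ : r \in _) /=; last by rewrite inE Br; apply: connect0.
apply: eq_card => t; rewrite !inE /bruhat_lt (eq_sym r t).
by rewrite andbA [RHS]andbC.
Qed.

Lemma card_bruhat_lt r : r \in B -> #|[set t in B | bruhat_lt t r]%SET| = (beta r).-1.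
Proof.
move=> Br; rewrite /beta [X in _ = X.-1](cardsD1 r).
rewrite (_ : r \in _) /=; last by rewrite inE Br; apply: connect0.
apply: eq_card => t; rewrite !inE /bruhat_lt.
by rewrite andbA [RHS]andbC.
Qed.

Lemma card_stars k l :
  #|[set x in finset.setX (finset.setX (ksubsets B k) (ksubsets B 1)) (ksubsets B l)
     | is_star k l x]%SET|
  = \sum_(r in B) 'C((alpha r).-1, k) * 'C((beta r).-1, l).
Proof.
rewrite -sum1_card (partition_big (fun x => x.1.2) (mem (ksubsets B 1))) /=; last first.
  by case=> [[P C] Q]; rewrite inE => /andP[/finset.setXP[/finset.setXP[]]].
rewrite ksubsets1 big_imset /=; last by move=> x y _ _; apply: finset.set1_inj.
apply: eq_bigr => r Br; rewrite -card_bruhat_gt // -card_bruhat_lt //.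
(* A factor 1, the number of choices for the center, turns the right side into the cardinality of a
   triple product. *)
rewrite -!card_ksubsets -[#|ksubsets _ k|]muln1.
rewrite -[X in _ = _ * X * _](cards1 [set r]%SET) -!cardsX -[RHS]sum1_card.
apply: eq_bigl => -[[P C] Q]; rewrite !inE /= -!andbA.
have sub_sep (A : {set 'S_n}) (E : pred 'S_n) :
  (A \subset [set t in B | E t]%SET) = (A \subset B) && [forall t in A, E t].
  apply/fintype.subsetP/andP => [sA|[/fintype.subsetP sA /forall_inP AE t At]].
    by split; [apply/fintype.subsetP|apply/forall_inP] => t /sA; rewrite inE => /andP[].
  by rewrite inE sA // AE.
rewrite !sub_sep; have [->|neC] := eqVneq C [set r]%SET; last by rewrite !andbF.
rewrite finset.sub1set Br imset_f //=.
have -> : [exists r0 : 'S_n, [&& [set r]%SET == [set r0]%SET,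
    [forall p in P, bruhat_lt r0 p] & [forall s in Q, bruhat_lt s r0]]] =
   [forall p in P, bruhat_lt r p] && [forall s in Q, bruhat_lt s r].
  apply/existsP/andP => [[r0 /and3P[/eqP/finset.set1_inj <-]]|[? ?]] //.
  by exists r; rewrite eqxx; apply/and3P.
by do ?[case: (_ \subset _) => //=]; do ?[case: (#|_| == _) => //=];
  rewrite ?andbT ?andbF //; do ?case: [forall p in _, _].
Qed.

Lemma star_prE (R : realType) k l :
  (star_pr R n k l =
   (\sum_(r in B) 'C((alpha r).-1, k) * 'C((beta r).-1, l))%N%:R
     / (#|B|%:R * 'C(#|B|, k)%:R * 'C(#|B|, l)%:R))%R.
Proof.
rewrite /star_pr /unif_pr card_stars !cardsX !card_ksubsets bin1 !natrM.
by rewrite (mulrC _%:R #|B|%:R)%R.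
Qed.

End Stars.

(** * Growth of convolutions *)

(** Coefficient comparison in (1-x)^-(p+1) (1-x)^-(q+1) = (1-x)^-(p+q+2). Pascal's rule splits the
    first binomial; the two resulting sums are the induction hypotheses in [p] and in [n]. *)
Lemma sum_bin_bin p q n :
  \sum_(i < n.+1) 'C(i + p, p) * 'C(n - i + q, q) = 'C((n + p + q).+1, (p + q).+1).
Proof.
elim: p n => [|p IHp] n.
  rewrite addn0 add0n; elim: n => [|n IHn]; first by rewrite big_ord1 !addn0 bin0 !binn.
  rewrite big_ord_recl subn0 addn0 bin0 mul1n binS -IHn addSn addnC; congr (_ + _).
  by apply: eq_bigr => i _; rewrite !bin0 lift0 subSS.
elim: n => [|n IHn]; first by rewrite big_ord1 !add0n !binn.
rewrite (eq_bigr (fun i : 'I_n.+2 =>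
   'C(i + p, p) * 'C(n.+1 - i + q, q) + 'C(i + p, p.+1) * 'C(n.+1 - i + q, q))); last first.
  by move=> i _; rewrite addnS binS mulnDl addnC.
rewrite big_split /= IHp big_ord_recl /= add0n. rewrite (bin_small (ltnSn p)) mul0n add0n.
under eq_bigr => i _ do rewrite /bump /= add1n subSS addSnnS.
by rewrite IHn !addSn !addnS binS addnC.
Qed.

Local Open Scope ring_scope.
Section Growth.
Variable R : realType.
Implicit Types (a b : nat -> R) (p q : nat) (A B : R).

(** Dividing by powers of [n.+1] keeps every denominator nonzero. The case [A = 0] expresses that
    [a] is of lower order than [n^p]. *)
Definition grows p A a : Prop :=
  ((fun n => a n / n.+1%:R ^+ p) @ \oo --> A)%classic.

Lemma eq_grows p A a b : a =1 b -> grows p A a -> grows p A b.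
Proof. by move=> /funext ->. Qed.

Lemma growsD p A B a b : grows p A a -> grows p B b ->
  grows p (A + B) (fun n => a n + b n).
Proof.
move=> ga gb; rewrite /grows; under eq_fun do rewrite mulrDl.
exact: cvgD.
Qed.

Lemma growsM p q A B a b : grows p A a -> grows q B b ->
  grows (p + q) (A * B) (fun n => a n * b n).
Proof.
move=> ga gb; rewrite /grows; under eq_fun do rewrite exprD invfM mulrACA.
exact: cvgM.
Qed.

Lemma growsZ p A c a : grows p A a -> grows p (c * A) (fun n => c * a n).
Proof. by move=> ga; rewrite /grows; under eq_fun do rewrite -mulrA; apply: cvgMr. Qed.

Lemma grows_cst c : grows 0 c (fun=> c).
Proof. by rewrite /grows; under eq_fun do rewrite expr0 divr1; apply: cvg_cst. Qed.

Lemma grows0 p A a : grows p A a -> grows p.+1 0 a.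
Proof.
move=> ga; rewrite /grows; under eq_fun do rewrite exprSr invfM mulrA.
by rewrite -(mulr0 A); apply: cvgM => //; apply: cvg_harmonic.
Qed.

Lemma growsX p A a k : grows p A a -> grows (p * k) (A ^+ k) (fun n => a n ^+ k).
Proof.
move=> ga; elim: k => [|k IH]; first by rewrite muln0 expr0; apply: grows_cst.
rewrite mulnS exprS; rewrite /grows; under eq_fun do rewrite exprS.
exact: growsM.
Qed.

Lemma grows_succ : grows 1 1 (fun n => n.+1%:R).
Proof.
rewrite /grows; under eq_fun do rewrite expr1 divff ?pnatr_eq0 //.
exact: cvg_cst.
Qed.

Lemma grows_addn c : grows 1 1 (fun n => (n + c)%:R).
Proof.
rewrite -(addr0 1); apply: eq_grows (growsD grows_succ (grows0 (@grows_cst (c%:R - 1)))).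
by move=> n; rewrite -addn1 !natrD; ring.
Qed.

Lemma grows_ffact p A (a : nat -> nat) k : (0 < p)%N ->
  grows p A (fun n => (a n)%:R) ->
  grows (p * k) (A ^+ k) (fun n => (a n ^_ k)%:R).
Proof.
move=> p_gt0 ga; elim: k => [|k IH].
  by rewrite muln0 expr0; under eq_fun do rewrite ffactn0; apply: grows_cst.
rewrite mulnSr exprSr /grows.
under eq_fun => n.
  rewrite (_ : (a n ^_ k.+1)%:R = (a n ^_ k)%:R * ((a n)%:R + - k%:R)).
  over.
  (* Truncated subtraction may become real subtraction, because the falling factorial vanishes when
     [a n < k]. *)
  have [le_k|gt_k] := leqP k (a n); first by rewrite ffactnSr natrM natrB.
  by rewrite !ffact_small ?mul0r // ltnW.
apply: growsM => //; rewrite -(addr0 A); apply: growsD => //.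
have /= := grows0 (@grows_cst (- k%:R)).
case: p p_gt0 {ga IH} => // p _; elim: p => // p IH /IH; exact: grows0.
Qed.

Lemma grows_bin p A (a : nat -> nat) k : (0 < p)%N ->
  grows p A (fun n => (a n)%:R) ->
  grows (p * k) (A ^+ k / k`!%:R) (fun n => 'C(a n, k)%:R).
Proof.
move=> p_gt0 /(grows_ffact (k := k) p_gt0)/(growsZ (c := k`!%:R^-1)).
rewrite mulrC; apply: eq_grows => n.
by rewrite -bin_ffact natrM mulrC mulfK // pnatr_eq0 -lt0n fact_gt0.
Qed.

Lemma grows_div p A B a b : grows p A a -> grows p B b -> B != 0 ->
  ((fun n => a n / b n) @ \oo --> A / B)%classic.
Proof.
move=> ga gb B0.
rewrite (_ : (fun n => a n / b n) =
  (fun n => a n / n.+1%:R ^+ p) \* (fun n => (b n / n.+1%:R ^+ p)^-1)).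
  exact: cvgM ga (cvgV B0 gb).
apply: funext => n /=.
by rewrite invfM invrK mulrACA mulVf ?mulr1 // expf_neq0 // pnatr_eq0.
Qed.

Definition convolution a b n : R := \sum_(i < n.+1) a i * b (n - i)%N.

Lemma convolutionC a b : convolution a b = convolution b a.
Proof.
apply: funext => n; rewrite /convolution (reindex_inj rev_ord_inj) /=.
apply: eq_bigr => i _; rewrite subSS mulrC; congr (b _ * _).
by rewrite subKn // -ltnS.
Qed.

(** Since [b] is bounded by a multiple of [j.+1 ^ q], the normalized convolution is at most a
    constant times the arithmetic mean of the normalized [a], which tends to 0. *)
Lemma grows_convolution0 p q B a b : grows p 0 a -> grows q B b ->
  grows (p + q).+1 0 (convolution a b).
Proof.
move=> ga gb.
have [M [_ MP]] := cvg_seq_bounded (cvgP _ gb).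
have {}MP j : `|b j| <= (M + 1) * j.+1%:R ^+ q.
  have /= := MP (M + 1) ltac:(by rewrite ltrDl) j I.
  by rewrite normrM normfV [`|_ ^+ q|]ger0_norm ?exprn_ge0 // ler_pdivrMr // exprn_gt0.
set u : nat -> R := fun n => `|a n / n.+1%:R ^+ p|.
have u0 : (u @ \oo --> (0 : R))%classic by have := cvg_norm ga; rewrite normr0; apply.
apply: norm_cvg0.
have lim0 : ((fun n => (M + 1) * arithmetic_mean u n) @ \oo --> (0 : R))%classic.
  by rewrite -(mulr0 (M + 1)); apply: cvgMr; apply: cesaro.
apply: (squeeze_cvgr _ (cvg_cst 0) lim0); apply: nearW => n; rewrite normr_ge0 /=.
have n1 : 0 < n.+1%:R :> R by rewrite ltr0n.
rewrite normrM normfV [`|_ ^+ _.+1|]ger0_norm ?exprn_ge0 ?ler0n //.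
rewrite ler_pdivrMr ?exprn_gt0 // /arithmetic_mean /series /= big_mkord.
rewrite [X in _ <= X](_ : _ = \sum_(i < n.+1) u i * ((M + 1) * n.+1%:R ^+ (p + q))); last first.
  rewrite -mulr_suml exprS; move: (lt0r_neq0 n1); set x := n.+1%:R => x0.
  by set S := \sum_(_ < _) _; field.
apply: (le_trans (ler_norm_sum _ _ _)); apply: ler_sum => i _.
rewrite normrM.
have -> : `|a i| = u i * i.+1%:R ^+ p.
  rewrite /u normrM normfV [`|_ ^+ p|]ger0_norm ?exprn_ge0 //.
  by rewrite divfK // expf_neq0 // pnatr_eq0.
have le1 : i.+1%:R ^+ p <= n.+1%:R ^+ p :> R.
  by apply: lerXn2r; rewrite ?nnegrE ?ler0n // ler_nat.
have le2 : (n - i).+1%:R ^+ q <= n.+1%:R ^+ q :> R.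
  by apply: lerXn2r; rewrite ?nnegrE ?ler0n // ler_nat ltnS leq_subr.
have M0 : 0 <= M + 1.
  by have := le_trans (normr_ge0 _) (MP 0%N); rewrite expr1n mulr1.
rewrite exprD -mulrA; apply: ler_wpM2l; first exact: normr_ge0.
rewrite mulrCA; apply: ler_pM; rewrite ?exprn_ge0 ?normr_ge0 ?ler0n //.
by apply: le_trans (MP _) _; apply: ler_wpM2l.
Qed.

End Growth.

Section Convolution.
Variable R : realType.
Implicit Types (a b : nat -> R) (p q : nat) (A B : R).

Lemma grows_bin_self p : grows p (1 / p`!%:R) (fun n => 'C(n + p, p)%:R : R).
Proof.
by have := grows_bin (p := 1) (k := p) isT (grows_addn (R := R) p); rewrite mul1n expr1n.
Qed.

Lemma grows_convolution p q A B a b : grows p A a -> grows q B b ->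
  grows (p + q).+1 (A * B * (p`! * q`!)%:R / (p + q).+1`!%:R) (convolution a b).
Proof.
move=> ga gb.
pose a' n : R := A * p`!%:R * 'C(n + p, p)%:R.
pose b' n : R := B * q`!%:R * 'C(n + q, q)%:R.
have fact0 m : m`!%:R != 0 :> R by rewrite pnatr_eq0 -lt0n fact_gt0.
have ga' : grows p A a'.
  by have := growsZ (c := A * p`!%:R) (@grows_bin_self p); rewrite mul1r mulfK.
have gb' : grows q B b'.
  by have := growsZ (c := B * q`!%:R) (@grows_bin_self q); rewrite mul1r mulfK.
have gea : grows p 0 (fun n => a n - a' n).
  have := growsD ga (growsZ (c := -1) ga'); rewrite mulN1r subrr.
  by apply: eq_grows => n; rewrite mulN1r.
have geb : grows q 0 (fun n => b n - b' n).
  have := growsD gb (growsZ (c := -1) gb'); rewrite mulN1r subrr.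
  by apply: eq_grows => n; rewrite mulN1r.
have main : grows (p + q).+1 (A * B * (p`! * q`!)%:R / (p + q).+1`!%:R)
    (fun n => A * B * (p`! * q`!)%:R * 'C(n + (p + q).+1, (p + q).+1)%:R).
  by have := growsZ (c := A * B * (p`! * q`!)%:R) (@grows_bin_self (p + q).+1); rewrite mul1r.
(* With * for convolution, a * b = a' * b' + (a - a') * b + a' * (b - b'), and the last two terms
   are of lower order. *)
have err1 := grows_convolution0 gea gb.
have := grows_convolution0 geb ga'; rewrite convolutionC addnC => err2.
have := growsD main (growsD err1 err2); rewrite !addr0; apply: eq_grows => n.
rewrite addnS addnA -sum_bin_bin natr_sum mulr_sumr /convolution -!big_split /=.
apply: eq_bigr => i _; rewrite /a' /b' natrM natrM; ring.
Qed.

(** The halving is exact: if [i.+1] and [w.+1] are both odd, their sum is even. *)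
Lemma half_prism_double i w : ((half_prism i w).*2 = i.+1 * w.+1 * (i + w).+2)%N.
Proof.
by rewrite /half_prism halfK !oddM /= oddD; case: (odd i); case: (odd w); rewrite subn0.
Qed.

(* Otherwise unification unfolds [half_prism] against numerals and diverges. *)
Opaque half_prism.

Lemma natr_half_prism i w :
  (half_prism i w)%:R = i.+1%:R * w.+1%:R * ((i + w).+2%:R / 2) :> R.
Proof.
have /(congr1 (fun x => x%:R : R)) := half_prism_double i w.
rewrite -muln2 !natrM mulrA => <-.
by rewrite mulfK // pnatr_eq0.
Qed.

Lemma leq_expn2r m n e : (m <= n)%N -> (m ^ e <= n ^ e)%N.
Proof. by case: e => // e; rewrite leq_exp2r. Qed.

Lemma ffact_le_expn m k : (m ^_ k <= m ^ k)%N.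
Proof.
by elim: k => // k IH; rewrite ffactnSr expnSr; apply: leq_mul => //; apply: leq_subr.
Qed.

(** Controls the error of replacing [h.-1 ^_ k] by [h ^ k]. Each new factor costs at most
    [k.+1 * h ^ k], and k^2 + k + 1 <= (k+1)^2. *)
Lemma expn_le_ffact_pred h k : (h ^ k <= h.-1 ^_ k + k ^ 2 * h ^ k.-1)%N.
Proof.
elim: k => [|k IH]; first by rewrite ffactn0.
have le_h : (h <= h.-1 - k + k.+1)%N by lia.
have le_ff : (h.-1 ^_ k <= h ^ k)%N.
  by apply: leq_trans (ffact_le_expn _ _) _; apply: leq_expn2r; lia.
have e_h : (k ^ 2 * (h * h ^ k.-1) = k ^ 2 * h ^ k)%N.
  by case: k {IH le_h le_ff} => // k; rewrite -expnS.
rewrite ffactnSr expnS /=.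
have := leq_mul (leqnn h) IH.
have := leq_mul le_h (leqnn (h.-1 ^_ k)).
move: e_h le_ff; move: (h.-1 ^_ k) (h ^ k)%N (h ^ k.-1)%N => f e e'.
nia.
Qed.

(** Up to lower order, k! times the sum is the sum of the powers [half_prism ^ k]. There (m+2)^k /
    2^k factors out and leaves the convolution of (i+1)^k with itself. *)
Lemma grows_half_prism_bin_sum k :
  grows (3 * k).+1 (k`!%:R / (2 ^+ k * (2 * k).+1`!%:R))
    (fun m => (half_prism_bin_sum k m)%:R : R).
Proof.
pose main m : R := (m.+2%:R / 2) ^+ k *
  convolution (fun i => i.+1%:R ^+ k) (fun i => i.+1%:R ^+ k) m.
have mainE m : main m = \sum_(i < m.+1) (half_prism i (m - i))%:R ^+ k.
  rewrite /main /convolution mulr_sumr; apply: eq_bigr => i _.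
  have le_im : (i <= m)%N by rewrite -ltnS.
  rewrite natr_half_prism.
  rewrite (subnKC le_im).
  rewrite !exprMn.
  by rewrite mulrC.
have gmain : grows (3 * k).+1 (k`!%:R / (2 ^+ k * (2 * k).+1`!%:R) * k`!%:R) main.
  have gk : grows k 1 (fun i : nat => i.+1%:R ^+ k : R).
    by have := growsX (k := k) (@grows_succ R); rewrite mul1n expr1n.
  have g2 : grows 1 (1 / 2) (fun m : nat => m.+2%:R / 2 : R).
    have := growsZ (c := 2^-1) (grows_addn (R := R) 2); rewrite mulrC.
    by apply: eq_grows => m; rewrite addn2 mulrC.
  have := growsM (growsX (k := k) g2) (grows_convolution gk gk).
  rewrite mul1n addnS (_ : (k + (k + k) = 3 * k)%N); last by lia.
  rewrite addnn -mul2n !mul1r natrM exprVn invfM.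
  by congr (grows _ _ _); rewrite mulrA mulrA; ring.
pose err m : R := main m - k`!%:R * (half_prism_bin_sum k m)%:R.
have gerr : grows (3 * k).+1 0 err.
  have bound : grows (3 * k).+1 0 (fun m : nat => (k ^ 2)%:R * m.+1%:R ^+ (3 * k) : R).
    rewrite -(mulr0 (k ^ 2)%:R); apply: growsZ; apply: (grows0 (A := 1)).
    have := growsX (k := 3 * k) (@grows_succ R).
    by rewrite mul1n expr1n.
  rewrite /grows; apply: (squeeze_cvgr _ (cvg_cst 0) bound); apply: nearW => m.
  have m1 : 0 < m.+1%:R ^+ (3 * k).+1 :> R by rewrite exprn_gt0 // ltr0n.
  rewrite divr_ge0 ?(ltW m1) //=; last first.
    rewrite /err mainE /half_prism_bin_sum natr_sum mulr_sumr -sumrB sumr_ge0 // => i _.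
    rewrite -natrM mulnC bin_ffact -natrX subr_ge0 ler_nat.
    apply: leq_trans (ffact_le_expn _ _) _; apply: leq_expn2r; lia.
  rewrite ler_pM2r ?invr_gt0 //.
  rewrite /err mainE /half_prism_bin_sum natr_sum mulr_sumr -sumrB.
  apply: (@le_trans _ _ (\sum_(i < m.+1) (k ^ 2 * (m.+1 ^ 3) ^ k.-1)%:R)); last first.
    rewrite sumr_const card_ord -mulrnA -natrX -natrM ler_nat.
    case: k {main mainE gmain err bound m1} => // k; rewrite -mulnA leq_mul2l /=.
    rewrite -expnM -expnSr; apply: leq_pexp2l; lia.
  apply: ler_sum => i _; rewrite -natrM mulnC bin_ffact -natrX lerBlDl -natrD ler_nat.
  apply: leq_trans (expn_le_ffact_pred _ _) _; rewrite leq_add2l leq_mul2l.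
  apply/orP; right; apply: leq_expn2r.
  (* The bound [half_prism i (m - i) <= m.+1 ^ 3] follows from [m.+2 <= m.+1 * 2]. *)
  have := half_prism_double i (m - i); have := ltn_ord i.
  rewrite -muln2; move: (half_prism _ _) => h lt_i e.
  have le1 : (i.+1 * (m - i).+1 <= m.+1 * m.+1)%N by apply: leq_mul; lia.
  have := leq_mul le1 (_ : (i + (m - i)).+2 <= m.+1 * 2)%N.
  rewrite -e => /(_ ltac:(lia)); rewrite !expnS expn0; nia.
have := growsZ (c := k`!%:R^-1) (growsD gmain (growsZ (c := -1) gerr)).
have fact0 : k`!%:R != 0 :> R by rewrite pnatr_eq0 -lt0n fact_gt0.
rewrite mulr0 addr0 mulrC mulfK //; apply: eq_grows => m.
by rewrite /err mulN1r opprB addrC subrK mulKf.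
Qed.

End Convolution.

(** * The limit and its closed form *)

Section Limit.
Variable R : realType.

Definition half_prism_const (k : nat) : R := k`!%:R / (2 ^+ k * (2 * k).+1`!%:R).

(** The coefficient A B p! q! / (p+q+1)! of a convolution, with p = 3k+1 and q = 3l+1. *)
Definition sum_const (k l : nat) : R :=
  half_prism_const k * half_prism_const l * ((3 * k).+1`! * (3 * l).+1`!)%:R
  / (3 * (k + l + 1))`!%:R.

Lemma grows_sum_bin_alpha_beta k l :
  grows (3 * (k + l + 1)) (sum_const k l) (fun N =>
    (\sum_(s in bigrassmannian N.+2) 'C((alpha s).-1, k) * 'C((beta s).-1, l))%N%:R : R).
Proof.
have := grows_convolution (@grows_half_prism_bin_sum R k) (@grows_half_prism_bin_sum R l).
rewrite (_ : ((3 * k).+1 + (3 * l).+1).+1 = 3 * (k + l + 1))%N; last by lia.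
apply: eq_grows => N; rewrite sum_bin_alpha_beta natr_sum /convolution.
by apply: eq_bigr => i _; rewrite natrM.
Qed.

(** For [k = l = 0] every summand is 1, so the previous sum is the cardinality itself. *)
Lemma grows_card_bigrassmannian :
  grows 3 (6^-1) (fun N => #|bigrassmannian N.+2|%:R : R).
Proof.
have e6 : sum_const 0 0 = 6^-1.
  rewrite /sum_const /half_prism_const !muln0 (_ : 3`! = 6)%N // (_ : 1`! = 1)%N //.
  by rewrite fact0 expr0; field.
have := @grows_sum_bin_alpha_beta 0 0; rewrite e6.
apply: eq_grows => N; congr (_%:R); rewrite -sum1_card.
by apply: eq_bigr => s _; rewrite !bin0.
Qed.

Lemma grows_star_denom k l :
  grows (3 * (k + l + 1)) (6^-1 ^+ (k + l + 1) / (k`!%:R * l`!%:R))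
    (fun N => #|bigrassmannian N.+2|%:R * 'C(#|bigrassmannian N.+2|, k)%:R
              * 'C(#|bigrassmannian N.+2|, l)%:R : R).
Proof.
have gc := grows_card_bigrassmannian.
have gk := grows_bin (k := k) (p := 3) isT gc.
have := growsM (growsM gc gk) (grows_bin (k := l) (p := 3) isT gc).
rewrite (_ : 3 + 3 * k + 3 * l = 3 * (k + l + 1))%N; last by lia.
congr (grows _ _ _); rewrite addn1 exprS exprD invfM; ring.
Qed.

(** The factorials (2k+1)!, (2l+1)! and (3(k+l+1))! are expanded through binomials; the powers
    combine to 6^(k+l+1) / (3 * 2^(k+l)) = 2 * 3^(k+l). *)
Lemma sum_const_ratio k l :
  sum_const k l / (6^-1 ^+ (k + l + 1) / (k`!%:R * l`!%:R)) =
  (2 * 3 ^+ (k + l))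
       / ((k + l + 1)%:R * 'C(3 * (k + l) + 2, 3 * k + 1)%:R
          * (2 * k + 1)%:R * 'C(2 * k, k)%:R
          * (2 * l + 1)%:R * 'C(2 * l, l)%:R) :> R.
Proof.
have nz (m : nat) : (0 < m)%N -> m%:R != 0 :> R by rewrite pnatr_eq0 lt0n.
have oddfact m : ((2 * m).+1`! = (2 * m + 1) * ('C(2 * m, m) * (m`! * m`!)))%N.
  by rewrite factS addn1 -(bin_fact (_ : m <= 2 * m)%N) 1?(_ : 2 * m - m = m)%N //; lia.
have bigfact : ((3 * (k + l + 1))`! =
    3 * (k + l + 1) * ('C(3 * (k + l) + 2, 3 * k + 1) * ((3 * k).+1`! * (3 * l).+1`!)))%N.
  rewrite (_ : 3 * (k + l + 1) = (3 * (k + l) + 2).+1)%N; last by lia.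
  rewrite factS -(@bin_fact (3 * (k + l) + 2) (3 * k + 1)); last by lia.
  by rewrite (_ : 3 * (k + l) + 2 - (3 * k + 1) = (3 * l).+1)%N ?addn1 //; lia.
rewrite /sum_const /half_prism_const !oddfact bigfact.
move: (fact_gt0 (3 * k).+1) (fact_gt0 (3 * l).+1).
move: ((3 * k).+1`!) ((3 * l).+1`!) => gk gl /nz gk0 /nz gl0; rewrite !natrM (addn1 (k + l)).
have e6 : (6 : R) = 2 * 3 by ring.
rewrite exprVn e6 exprS !exprMn !exprD.
have := nz _ (fact_gt0 k); have := nz _ (fact_gt0 l).
have : 'C(3 * (k + l) + 2, 3 * k + 1)%:R != 0 :> R by apply: nz; rewrite bin_gt0; lia.
have : 'C(2 * k, k)%:R != 0 :> R by apply: nz; rewrite bin_gt0; lia.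
have : 'C(2 * l, l)%:R != 0 :> R by apply: nz; rewrite bin_gt0; lia.
have : (2 * k + 1)%:R != 0 :> R by apply: nz; lia.
have : (2 * l + 1)%:R != 0 :> R by apply: nz; lia.
have : (k + l).+1%:R != 0 :> R by apply: nz.
have : (2 : R) ^+ k != 0 by rewrite expf_neq0 // pnatr_eq0.
have : (2 : R) ^+ l != 0 by rewrite expf_neq0 // pnatr_eq0.
have : (3 : R) ^+ k != 0 by rewrite expf_neq0 // pnatr_eq0.
have : (3 : R) ^+ l != 0 by rewrite expf_neq0 // pnatr_eq0.
(* With powers, factorials and binomials abstracted to nonzero atoms, a rational identity remains
   for [field]. *)
move: (2 ^+ k) (2 ^+ l) (3 ^+ k) (3 ^+ l) => a2 b2 a3 b3.
move: (k`!%:R) (l`!%:R) gk%:R gl%:R gk0 gl0 => fk fl {}gk {}gl gk0 gl0.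
move: ('C(_, _)%:R) ('C(2 * k, _)%:R) ('C(2 * l, _)%:R) => c ck cl.
move: ((2 * k + 1)%:R) ((2 * l + 1)%:R) ((k + l).+1%:R) => ok ol okl.
move=> *; field.
by repeat (apply/andP; split=> //).
Qed.

End Limit.

Theorem theorem5p2 (R : realType) (k l : nat) :
  (forall n : nat, (2 <= n)%N -> (maxn k l <= #|bigrassmannian n|)%N ->
     star_pr R n k l =
       unif_expect (bigrassmannian n)
         (fun r : 'S_n => ('C((alpha r).-1, k) * 'C((beta r).-1, l))%:R : R)
       / ('C(#|bigrassmannian n|, k)%:R * 'C(#|bigrassmannian n|, l)%:R))
  /\
  asymp_equiv (fun n : nat => star_pr R n k l)
    (fun _ : nat =>
       (2 * 3 ^+ (k + l))
       / ((k + l + 1)%:R * 'C(3 * (k + l) + 2, 3 * k + 1)%:R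
          * (2 * k + 1)%:R * 'C(2 * k, k)%:R
          * (2 * l + 1)%:R * 'C(2 * l, l)%:R)).
Proof.
split=> [n _ _|].
  by rewrite star_prE /unif_expect natr_sum -!mulrA !invfM !mulrA.
rewrite /asymp_equiv -sum_const_ratio.
set L := sum_const R k l / _.
have fact_neq0 m : m`!%:R != 0 :> R by rewrite pnatr_eq0 -lt0n fact_gt0.
have denom_neq0 : 6^-1 ^+ (k + l + 1) / (k`!%:R * l`!%:R) != 0 :> R.
  by rewrite mulf_neq0 ?invr_eq0 ?mulf_neq0 // expf_neq0 // invr_eq0 pnatr_eq0.
have L_neq0 : L != 0.
  have const_neq0 m : half_prism_const R m != 0.
    by rewrite mulf_neq0 // invr_eq0 mulf_neq0 // expf_neq0 // pnatr_eq0.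
  apply: mulf_neq0; last by rewrite invr_eq0.
  apply: mulf_neq0; last by rewrite invr_eq0.
  apply: mulf_neq0; first exact: mulf_neq0.
  by rewrite pnatr_eq0 muln_eq0 negb_or -!lt0n !fact_gt0.
(* The growth estimates are indexed by [N] with [n = N.+2]; writing the limit 1 as [L / L] reduces
   the goal to convergence to [L]. *)
rewrite -(cvg_shiftn 2) -(divff L_neq0) /=; apply: cvgMl.
have := grows_div (@grows_sum_bin_alpha_beta R k l) (@grows_star_denom R k l) denom_neq0.
rewrite -/L; apply: cvg_trans; apply: near_eq_cvg; apply: nearW => N.
by rewrite star_prE addn2.
Qed.
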